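(* Let $G=\prod_{1\leq i\leq k}C_{p^{r_i}}$ be a finite non-cyclic abelian $p$-group with $r_1\geq r_2\geq\dots\geq r_k$ and $k\geq 2$, and let $x_1$ be a generator of the factor $C_{p^{r_1}}$. Then the set of dominant vertices of $\Delta_D(G)$ is $\langle x_1^{p^{r_2}}\rangle$.
   Context: $C_n$ denotes the cyclic group of order $n$. The deep commuting graph $\Delta_D(G)$ has vertex set $G$, distinct vertices adjacent iff their preimages commute in a Schur cover $\tilde G$ of $G$ (a central extension $\{e\}\to M(G)\to\tilde G\to G\to\{e\}$ with kernel contained in $Z(\tilde G)\cap[\tilde G,\tilde G]$, of maximal order; $M(G)$ the Schur multiplier). A vertex is dominant if it is adjacent to every other vertex. *)

(* Defs.v *)
From mathcomp Require Import all_boot all_fingroup all_solvable.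
Set Implicit Arguments. Unset Strict Implicit. Unset Printing Implicit Defensive.
Local Open Scope group_scope.

Definition stem_ext (gT hT : finGroupType) (G : {set gT}) (H : {group hT})
  (f : {morphism H >-> gT}) : Prop :=
  f @* H = G /\ 'ker f \subset 'Z(H) :&: H^`(1).

Definition schur_cover (gT hT : finGroupType) (G : {set gT}) (H : {group hT})
  (f : {morphism H >-> gT}) : Prop :=
  stem_ext G f /\
  forall (kT : finGroupType) (K : {group kT}) (f' : {morphism K >-> gT}),
    stem_ext G f' -> #|'ker f'| <= #|'ker f|.

(* Adjacency relation of the deep commuting graph (computed in the Schur
   cover f : H ->> G): preimages commute. *)
Definition deep_adj (gT hT : finGroupType) (H : {group hT})
  (f : {morphism H >-> gT}) (g h : gT) : Prop :=
  forall a b, a \in H -> b \in H -> f a = g -> f b = h -> commute a b.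

Definition dominant (gT hT : finGroupType) (G : {set gT}) (H : {group hT})
  (f : {morphism H >-> gT}) (g : gT) : Prop :=
  g \in G /\ forall h, h \in G -> h <> g -> deep_adj f g h.

(* Main.v *)
(* In a stem extension [H] of an abelian group [G] the kernel is [H^`(1)], and
   the commutator of two elements of [H] depends bilinearly on their images in
   [G].  A power of [x_1] divisible by the orders of all the other generators
   lifts to a central element.  Conversely, if a lift of [prod x_i^a_i] is
   central, then [x_j^a_1 = x_j^a_j = 1] for each [j > 1]: an alternating form
   on [G] with value [x_j] at [(x_1, x_j)] and trivial on other pairs of
   generators can be combined with the commutator form of [H] to twist [G]
   into another stem extension, whose kernel surjects onto that of [H].  By
   maximality this is a bijection, so a relation between commutators in [H]
   holds for the alternating form as well. *)
From HB Require Import structures.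
Require Import Defs.
From mathcomp Require Import all_boot all_fingroup all_solvable.
From mathcomp Require Import ssralg finalg.
Local Open Scope group_scope.
Set Implicit Arguments.
Unset Strict Implicit.
Unset Printing Implicit Defensive.
Import FiniteModule GRing.Theory.

(** * Central extensions by bilinear cocycles *)

Section CocycleExtension.

Variables (gT : finGroupType) (V : finZmodType) (b : gT -> gT -> V).
Hypothesis bMl : forall x y z, b (x * y) z = (b x z + b y z)%R.
Hypothesis bMr : forall x y z, b x (y * z) = (b x y + b x z)%R.

Lemma bilin1l x : b 1 x = 0%R.
Proof. by apply: (addrI (b 1 x)); rewrite -bMl mulg1 addr0. Qed.

Lemma bilin1r x : b x 1 = 0%R.
Proof. by apply: (addrI (b x 1)); rewrite -bMr mulg1 addr0. Qed.

Lemma bilinVl x y : b x^-1 y = (- b x y)%R.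
Proof. by apply: (addrI (b x y)); rewrite -bMl mulgV bilin1l addrN. Qed.

(* The unused arguments record bilinearity, on which the group laws depend. *)
Definition cocycle_ext
  of (forall x y z, b (x * y) z = (b x z + b y z)%R)
   & (forall x y z, b x (y * z) = (b x y + b x z)%R) := (gT * V)%type.

Local Notation ext := (cocycle_ext bMl bMr).

HB.instance Definition _ := Finite.on ext.

Definition ext_mul (u v : ext) : ext :=
  (u.1 * v.1, (u.2 + v.2 + b u.1 v.1)%R).
Definition ext_one : ext := (1, 0%R).
(** The correction term comes from [b x^-1 x = - b x x]. *)
Definition ext_inv (u : ext) : ext := (u.1^-1, (- u.2 + b u.1 u.1)%R).

Lemma ext_mulA : associative ext_mul.
Proof.
move=> [x u] [y v] [z w]; congr (_, _); rewrite /= ?mulgA // bMl bMr.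
by rewrite !addrA [LHS](ACl (1*2*5*3*6*4)).
Qed.

Lemma ext_mul1 : left_id ext_one ext_mul.
Proof.
by case=> x u; congr (_, _); rewrite /= ?mul1g // bilin1l add0r addr0.
Qed.

Lemma ext_mulV : left_inverse ext_one ext_inv ext_mul.
Proof.
case=> x u; congr (_, _); rewrite /= ?mulVg // bilinVl.
by rewrite addrAC addrK addNr.
Qed.

HB.instance Definition _ :=
  Finite_isGroup.Build ext ext_mulA ext_mul1 ext_mulV.

Lemma ext_mulE (u v : ext) :
  u * v = (u.1 * v.1, (u.2 + v.2 + b u.1 v.1)%R) :> ext.
Proof. by []. Qed.

Definition ext_in (v : V) : ext := (1, v).

Lemma ext_in_morphM : {in setT &, {morph ext_in : u v / u * v}}.
Proof. by move=> u v _ _; rewrite ext_mulE /= mulg1 bilin1l addr0. Qed.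

(** As [V] is abelian, [u * v] and [v * u] differ only in their cocycle terms. *)
Lemma ext_commg (u v : ext) :
  commute u.1 v.1 -> [~ u, v] = ext_in (b u.1 v.1 - b v.1 u.1)%R.
Proof.
move=> cuv; apply: (@mulgI ext (v * u)).
rewrite -commgC !ext_mulE /= mulg1 bilin1r addr0 cuv (addrC v.2).
by congr (_, _); rewrite -!addrA [(_ + (_ - _))%R]addrC subrK.
Qed.

End CocycleExtension.

(** In the cocycle extension, the copy of [A] is central because [b] vanishes when an argument is 1.
    It lies in the derived subgroup because commutators are the differences [b x y - b y x], which
    generate [A]. The base is [[subg G]], since [b] is bilinear only on [G]. *)
Lemma stem_ext_of_bilinear (gT aT : finGroupType) (G : {group gT})
    (A : {group aT}) (abA : abelian A) (b : gT -> gT -> fmod_of abA) :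
  abelian G ->
  {in G & &, forall x y z, b (x * y) z = (b x z + b y z)%R} ->
  {in G & &, forall x y z, b x (y * z) = (b x y + b x z)%R} ->
  A \subset <<[set fmval (b x y - b y x)%R | x in G, y in G]>> ->
  exists (kT : finGroupType) (K : {group kT}) (f : {morphism K >-> gT}),
    stem_ext G f /\ #|'ker f| = #|A|.
Proof.
move=> abG bMl bMr genA.
pose c (x y : [subg G]) := b (sgval x) (sgval y).
have cMl x y z : c (x * y) z = (c x z + c y z)%R by apply: bMl; apply: subgP.
have cMr x y z : c x (y * z) = (c x y + c x z)%R by apply: bMr; apply: subgP.
pose E := cocycle_ext cMl cMr; pose f (u : E) := sgval u.1.
have fM : {in [set: E]%G &, {morph f : u v / u * v}} by [].
pose phi := Morphism fM; pose incl (a : aT) := ext_in cMl cMr (fmod abA a).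
have inclM : {in A &, {morph incl : u v / u * v}}.
  by move=> u v Au Av; rewrite /incl fmodM // ext_in_morphM ?inE.
pose iota := Morphism inclM.
have kerE : 'ker phi = iota @* A.
  apply/setP=> -[x v]; apply/kerP/morphimP=> /= [|fx1|[a _ _ [-> _]] //].
    by rewrite inE.
  exists (fmval v); rewrite ?fmodP // /incl /= fmvalK; congr (_, _).
  by apply: (can_inj (@sgvalK _ G)); apply: fx1.
exists E, [set: E]%G, phi; split; last first.
  rewrite kerE card_injm //; apply/injmP=> u v Au Av [].
  by rewrite !subgK.
split.
  apply/setP=> x; apply/morphimP/idP=> [[u _ _ ->]|Gx]; first exact: subgP.
  by exists ((subg G x, 0%R) : E); rewrite ?inE //= /f subgK.
rewrite subsetI; apply/andP; split.
  apply/subsetP=> u; rewrite kerE => /morphimP[a _ Aa ->].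
  apply/centerP; split=> [|v _]; first by rewrite inE.
  rewrite /commute /= !ext_mulE /= mul1g mulg1 bilin1l // bilin1r //.
  by rewrite !addr0 addrC.
have sgA : [set fmval (b x y - b y x)%R | x in G, y in G] \subset A.
  by apply/subsetP=> _ /imset2P[x y _ _ ->]; apply: fmodP.
rewrite kerE (subset_trans (morphimS iota genA)) // morphim_gen //.
rewrite gen_subG; apply/subsetP=> _ /morphimP[a _ + ->].
case/imset2P=> x y Gx Gy -> /=; rewrite /incl fmvalK.
have -> : ext_in cMl cMr (b x y - b y x)%R =
    [~ (subg G x, 0%R) : E, (subg G y, 0%R) : E].
  rewrite ext_commg /c /= ?subgK //.
  by apply: (can_inj (@sgvalK _ G)); rewrite /= !subgK // (centsP abG).
by rewrite mem_commg ?inE.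
Qed.

(** * Coordinates in a direct product of cyclic groups *)

Section CyclicDecomposition.

Variables (gT : finGroupType) (I : finType) (x : I -> gT) (G : {group gT}).
Hypothesis dxG : \big[dprod/1]_i <[x i]> = G.

Lemma bigdprod_cycle_abelian : abelian G.
Proof.
apply/center_idP; rewrite -(center_bigcprod (bigdprodWcp dxG)).
rewrite -(bigdprodWcp dxG); apply: eq_bigr => i _.
exact/center_idP/cycle_abelian.
Qed.

Lemma bigdprod_cycle_mem i : x i \in G.
Proof.
rewrite -(bigdprodWY dxG) mem_gen //; apply/bigcupP.
by exists i; rewrite ?cycle_id.
Qed.

Lemma bigdprod_cycle_coord :
  exists e : gT -> I -> nat,
    {in G, forall g, g = \prod_i x i ^+ e g i
      /\ forall n, g = \prod_i x i ^+ n i ->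
         forall i, e g i = n i %[mod #[x i]]}.
Proof.
(* The implication makes the condition vacuous outside [G], so exponents can be chosen for every
   [g]. *)
have ex g : exists n : {dffun forall i, 'I_#[x i]},
    (g \in G) ==> (g == \prod_i x i ^+ n i).
  case Gg: (g \in G); last first.
    by exists [ffun i => Ordinal (order_gt0 (x i))].
  have [c [cP -> _]] := mem_bigdprod dxG Gg.
  have /fin_all_exists[n nP] i : exists n : 'I_#[x i], c i = x i ^+ n.
    have /cyclePmin[m ltm ->] := cP i isT.
    by exists (Ordinal ltm).
  exists [ffun i => n i]; apply/eqP/eq_bigr => i _.
  by rewrite ffunE nP.
exists (fun g i => nat_of_ord (xchoose (ex g) i)) => g Gg.
have /eqP eg := implyP (xchooseP (ex g)) Gg; split=> // n en i.
have [c [_ _ uniq_c]] := mem_bigdprod dxG Gg.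
have uniq_exp m : g = \prod_i x i ^+ m i -> x i ^+ m i = c i.
  move=> em; apply: (uniq_c (fun i => x i ^+ m i)) => // j _.
  exact: mem_cycle.
by apply/eqP; rewrite -eq_expg_mod_order (uniq_exp _ eg) (uniq_exp _ en).
Qed.

(* The values [c i j] on pairs of generators extend to a bilinear cocycle on
   [G] because each is killed by the orders of both [x i] and [x j]. *)
Lemma stem_ext_of_matrix (aT : finGroupType) (A : {group aT})
    (c : I -> I -> aT) :
  abelian A -> (forall i j, c i j \in A) ->
  (forall i j, c i j ^+ #[x i] = 1) -> (forall i j, c i j ^+ #[x j] = 1) ->
  A \subset <<[set c i j * (c j i)^-1 | i in I, j in I]>> ->
  exists (kT : finGroupType) (K : {group kT}) (f : {morphism K >-> gT}),
    stem_ext G f /\ #|'ker f| = #|A|.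
Proof.
move=> abA Ac cl cr genA; have [e eP] := bigdprod_cycle_coord.
have abG := bigdprod_cycle_abelian; have Gx := bigdprod_cycle_mem.
have eM : {in G &, forall g h i, e (g * h) i = (e g i + e h i)%N %[mod #[x i]]}.
  move=> g h Gg Gh i.
  apply: (eP _ (groupM Gg Gh)).2 (fun i => e g i + e h i)%N _ i.
  rewrite {1}(eP g Gg).1 {1}(eP h Gh).1 -prodgM_commute.
    by apply: eq_bigr => j _; rewrite expgD.
  by move=> *; apply: (centsP abG); rewrite groupX.
have e_x j i : e (x j) i = (i == j) %[mod #[x i]].
  apply: (eP _ (Gx j)).2 (fun i => i == j : nat) _ i.
  transitivity (\prod_(i | i == j) x i); first by rewrite big_pred1_eq.
  by rewrite big_mkcond; apply: eq_bigr => k _; case: (k == j); rewrite ?expg1.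
(* Coordinates are additive only modulo the orders of the generators; this absorbs the ambiguity. *)
have mulrn_mod d (v : fmod_of abA) m n :
    (v *+ d = 0)%R -> m = n %[mod d] -> (v *+ m = v *+ n)%R.
  move=> v0 mn; rewrite (divn_eq m d) (divn_eq n d) !mulrnDr mn.
  by rewrite ![(_ * d)%N]mulnC !mulrnA v0 !mul0rn.
pose F i j := fmod abA (c i j).
have Fl i j : (F i j *+ #[x i] = 0)%R by rewrite -fmodX // cl fmod1.
have Fr i j : (F i j *+ #[x j] = 0)%R by rewrite -fmodX // cr fmod1.
pose b g h := (\sum_i \sum_j F i j *+ (e g i * e h j))%R.
have bx i j : b (x i) (x j) = F i j.
  rewrite /b (bigD1 i) //= [X in (_ + X)%R]big1 ?addr0; last first.
    move=> k ki; rewrite big1 // => l _; rewrite mulrnA.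
    by rewrite (mulrn_mod _ _ _ _ (Fl k l) (e_x i k)) (negPf ki) mul0rn.
  rewrite (bigD1 j) //= [X in (_ + X)%R]big1 ?addr0; last first.
    move=> l lj; rewrite mulnC mulrnA.
    by rewrite (mulrn_mod _ _ _ _ (Fr i l) (e_x j l)) (negPf lj) mul0rn.
  rewrite mulrnA (mulrn_mod _ _ _ _ (Fl i j) (e_x i i)) eqxx.
  by rewrite (mulrn_mod _ _ _ _ (Fr i j) (e_x j j)) eqxx.
apply: (@stem_ext_of_bilinear _ _ G A abA b) => //.
- move=> g h l Gg Gh Gl; rewrite /b -big_split; apply: eq_bigr => i _ /=.
  rewrite -big_split; apply: eq_bigr => j _ /=.
  rewrite !mulrnA -mulrnDl -mulrnDr.
  by rewrite (mulrn_mod _ _ _ _ (Fl i j) (eM _ _ Gg Gh i)).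
- move=> g h l Gg Gh Gl; rewrite /b -big_split; apply: eq_bigr => i _ /=.
  rewrite -big_split; apply: eq_bigr => j _ /=.
  rewrite ![(e g i * _)%N]mulnC !mulrnA -mulrnDl -mulrnDr.
  by rewrite (mulrn_mod _ _ _ _ (Fr i j) (eM _ _ Gh Gl j)).
apply: subset_trans genA (genS _); apply/subsetP=> _ /imset2P[i j _ _ ->].
apply/imset2P; exists (x i) (x j); rewrite ?Gx // !bx.
by rewrite fmvalA fmvalN /= !fmodK.
Qed.

(** * Commutators in a stem extension of an abelian group *)

Section StemExtension.

Variables (hT : finGroupType) (H : {group hT}) (f : {morphism H >-> gT}).
Variable y : I -> hT.
Hypotheses (stem_f : stem_ext G f).
Hypotheses (Hy : forall i, y i \in H) (fy : forall i, f (y i) = x i).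

Lemma stem_ext_ker : 'ker f = H^`(1).
Proof.
have [fHG] := stem_f; rewrite subsetI => /andP[_ sKH'].
apply/eqP; rewrite eqEsubset sKH' -sub_morphim_pre ?der_sub //.
rewrite morphim_der // fHG.
by rewrite (derG1P bigdprod_cycle_abelian) subxx.
Qed.

Lemma stem_ext_der_center : H^`(1) \subset 'Z(H).
Proof. by rewrite -stem_ext_ker; have [_ /subsetIP[]] := stem_f. Qed.

Lemma stem_ext_commg_center u v : u \in H -> v \in H -> [~ u, v] \in 'Z(H).
Proof. by move=> Hu Hv; apply/(subsetP stem_ext_der_center)/mem_commg. Qed.

(** The conjugation in the expansion of [[~ a * b, v]] disappears because commutators are
    central. *)
Lemma stem_ext_commgM v :
  v \in H -> {in H &, {morph commg^~ v : a b / a * b}}.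
Proof.
move=> Hv a b Ha Hb /=; rewrite commMgJ; congr (_ * _).
have /centerP[_ cavH] := stem_ext_commg_center Ha Hv.
by rewrite /conjg cavH // mulKg.
Qed.

Lemma stem_ext_commXg u v n :
  u \in H -> v \in H -> [~ u ^+ n, v] = [~ u, v] ^+ n.
Proof. by move=> Hu Hv; apply: (morphX (Morphism (stem_ext_commgM Hv))). Qed.

Lemma stem_ext_sub (S : {group hT}) :
  'ker f \subset S -> (forall i, y i \in S) -> H \subset S.
Proof.
move=> sKS Sy; have [fHG _] := stem_f.
rewrite -(morphimSGK (subxx H) sKS) fHG -(bigdprodWY dxG) gen_subG.
apply/bigcupsP=> i _; rewrite cycle_subG -fy mem_morphim //.
Qed.

Lemma stem_ext_commg_order i j : [~ y i, y j] ^+ #[x i] = 1.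
Proof.
rewrite -stem_ext_commXg //; apply/eqP/commgP.
have : y i ^+ #[x i] \in 'ker f.
  by apply/kerP; rewrite ?groupX // morphX // fy expg_order.
rewrite stem_ext_ker => /(subsetP stem_ext_der_center)/centerP[_].
by apply.
Qed.

(** Bilinearity reduces all commutators to those of the lifts [y i], one argument at a time. *)
Lemma stem_ext_der_gen :
  H^`(1) \subset <<[set [~ y i, y j] | i in I, j in I]>>.
Proof.
pose D := <<[set [~ y i, y j] | i in I, j in I]>>%G.
rewrite -[<<_>>]/(gval D).
have sDH' : D \subset H^`(1).
  by rewrite gen_subG; apply/subsetP=> _ /imset2P[i j _ _ ->]; apply: mem_commg.
(* The preimage of [D] under the morphism [[~ _, v]] contains the central kernel of [f], so it is
   all of [H] once it contains each [y i]. *)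
have in_pre v (Hv : v \in H) :
    (forall i, [~ y i, v] \in D) -> forall u, u \in H -> [~ u, v] \in D.
  move=> Dyv; pose g := Morphism (stem_ext_commgM Hv).
  have sHg : H \subset g @*^-1 D.
    apply: stem_ext_sub => [|i]; last by rewrite !inE Hy Dyv.
    apply/subsetP=> u; rewrite stem_ext_ker => /(subsetP stem_ext_der_center).
    case/centerP=> Hu cuH; rewrite !inE Hu /=.
    by have /commgP/eqP-> := cuH v Hv; rewrite group1.
  by move=> u /(subsetP sHg); rewrite !inE => /andP[].
rewrite gen_subG; apply/subsetP=> _ /imset2P[u v Hu Hv ->].
apply: (in_pre) => // i; rewrite -groupV invg_comm; apply: in_pre => // j.
by rewrite mem_gen //; apply/imset2P; exists j i.
Qed.

(** Up to the central kernel, [u] is [y i0 ^+ m]. Its commutator with [y j] is [[~ y i0, y j] ^+ m],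
    trivial since the order of [x j] kills the commutator and divides [m] when [j != i0]. *)
Lemma stem_ext_center (i0 : I) (m : nat) (u : hT) :
  (forall j, j != i0 -> #[x j] %| m) ->
  u \in H -> f u = x i0 ^+ m -> u \in 'Z(H).
Proof.
move=> xm Hu fu; have sKZ : 'ker f \subset 'Z(H).
  by rewrite stem_ext_ker stem_ext_der_center.
have Hw : y i0 ^+ m \in H by rewrite groupX.
have /rcosetP[z Kz ->] : u \in 'ker f :* (y i0 ^+ m).
  by apply/rcoset_kerP; rewrite // fu morphX // fy.
apply: groupM; first exact: subsetP Kz.
suff sHC : H \subset 'C[y i0 ^+ m].
  by apply/centerP; split=> // v /(subsetP sHC)/cent1P.
apply: stem_ext_sub => [|j].
  apply: subset_trans sKZ (subset_trans (subsetIr _ _) _).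
  by rewrite /= -cent_set1 centS ?sub1set.
apply/cent1P/commute_sym/commgP; rewrite stem_ext_commXg //.
have [->|ji0] := eqVneq j i0; first by rewrite commgg expg1n.
rewrite -invg_comm expgVn invg_eq1 -order_dvdn.
apply: dvdn_trans (xm j ji0).
by rewrite order_dvdn stem_ext_commg_order.
Qed.

End StemExtension.

(** * Consequences of maximality *)

(* Pairing the commutators of lifts with an arbitrary compatible matrix [t]
   gives a stem extension whose kernel surjects onto that of [f]; maximality
   makes this surjection injective, so the relations between commutators in
   [H] are also satisfied by the alternating form attached to [t]. *)
Lemma schur_cover_alternating (hT : finGroupType) (H : {group hT})
    (f : {morphism H >-> gT}) (y : I -> hT)
    (aT : finGroupType) (B : {group aT}) (t : I -> I -> aT) :
  schur_cover G f ->
  (forall i, y i \in H) -> (forall i, f (y i) = x i) ->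
  abelian B -> (forall i j, t i j \in B) ->
  (forall i j, t i j ^+ #[x i] = 1) -> (forall i j, t i j ^+ #[x j] = 1) ->
  forall (a : I -> nat) (j : I), commute (\prod_i y i ^+ a i) (y j) ->
  \prod_i (t i j * (t j i)^-1) ^+ a i = 1.
Proof.
move=> [stem_f max_f] Hy fy abB Bt tl tr a j cyj.
pose d i l : hT * aT := ([~ y i, y l], t i l * (t l i)^-1).
(* Keeping only the pairs with [i] before [l] makes the antisymmetrization of [c] equal to [d]; that
   of [d] itself would be its square. *)
pose c i l := if enum_rank i < enum_rank l then d i l else 1.
have dV i l : (d l i)^-1 = d i l.
  by congr (_, _); rewrite /= ?invg_comm // invMg invgK.
have cE i l : c i l * (c l i)^-1 = d i l.
  rewrite /c; case: ltngtP => [_|_|/ord_inj/enum_rank_inj->].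
  - by rewrite invg1 mulg1.
  - by rewrite mul1g dV.
  - by rewrite invg1 mulg1; congr (_, _); rewrite /= ?commgg ?mulgV.
pose A := <<[set d i l | i in I, l in I]>>%G.
have Ad i l : d i l \in A by rewrite mem_gen //; apply/imset2P; exists i l.
have sAX : A \subset setX H^`(1) B.
  rewrite gen_subG; apply/subsetP=> _ /imset2P[i l _ _ ->].
  by rewrite !inE /= mem_commg ?groupM ?groupV.
have abX : abelian (setX H^`(1) B).
  have abH' : abelian H^`(1).
    by apply: abelianS (stem_ext_der_center stem_f) _; apply: center_abelian.
  apply/centsP=> -[u1 u2] /setXP[Hu Bu] [v1 v2] /setXP[Hv Bv].
  by congr (_, _); [apply: (centsP abH') | apply: (centsP abB)].
have tM i l n : t i l ^+ n = 1 -> t l i ^+ n = 1 ->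
    (t i l * (t l i)^-1) ^+ n = 1.
  move=> til tli; rewrite expgMn; last by apply: (centsP abB); rewrite ?groupV.
  by rewrite expgVn til tli invg1 mulg1.
have expE (u : hT * aT) n : u ^+ n = (u.1 ^+ n, u.2 ^+ n).
  by elim: n => // n IHn; rewrite !expgS IHn.
have dl i l : d i l ^+ #[x i] = 1.
  by rewrite expE /= (stem_ext_commg_order stem_f) // tM.
have dr i l : d i l ^+ #[x l] = 1 by rewrite -dV expgVn dl invg1.
have [i l|i l|i l||kT [K [f' [stem_f' cardK]]]] :=
    @stem_ext_of_matrix _ A c (abelianS sAX abX).
- by rewrite /c; case: ifP.
- by rewrite /c; case: ifP; rewrite ?expg1n.
- by rewrite /c; case: ifP; rewrite ?expg1n.
- rewrite genS //; apply/subsetP=> _ /imset2P[i l _ _ ->].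
  by apply/imset2P; exists i l; rewrite ?cE.
have fstA : fst @: A = H^`(1).
  apply/eqP; rewrite eqEsubset; apply/andP; split.
    by apply/subsetP=> _ /imsetP[[v w] /(subsetP sAX)/setXP[? _] ->].
  rewrite -(morphimEsub (fst_morphism _ _)) ?subsetT //.
  apply: subset_trans (stem_ext_der_gen stem_f Hy fy) _.
  rewrite gen_subG; apply/subsetP=> _ /imset2P[i l _ _ ->].
  by apply/morphimP; exists (d i l); rewrite ?inE.
have inj_fst : {in A &, injective fst}.
  apply/imset_injP; rewrite eqn_leq leq_imset_card fstA.
  by rewrite -(stem_ext_ker stem_f) -cardK max_f.
pose u := \prod_i d i j ^+ a i.
have Au : u \in A by apply: group_prod => i _; rewrite groupX.
(* By bilinearity [u.1] is the commutator of the given product with [y j]; injectivity then forces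
   [u = 1], hence [u.2 = 1]. *)
have u1 : u.1 = 1.
  rewrite (morph_prod (fst_morphism _ _)) /=; last by move=> i; rewrite inE.
  transitivity [~ \prod_i y i ^+ a i, y j]; last exact/eqP/commgP.
  pose g := Morphism (stem_ext_commgM stem_f (Hy j)).
  rewrite -[RHS]/(g (\prod_i y i ^+ a i)) morph_prod; last first.
    by move=> i _; rewrite groupX.
  by apply: eq_bigr => i _; rewrite expE /= (stem_ext_commXg stem_f).
transitivity u.2; last by rewrite (inj_fst u 1).
rewrite (morph_prod (snd_morphism _ _)) /=; last by move=> i; rewrite inE.
by apply: eq_bigr => i _; rewrite expE.
Qed.

(** The test matrix has the single entry [x j0] at [(i0, j0)], and the divisibility of orders makes
    it compatible. Its alternating form against [j0] isolates [a i0]; against [i0] it isolates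
    [a j0], up to inversion. *)
Lemma schur_cover_commute_pair (hT : finGroupType) (H : {group hT})
    (f : {morphism H >-> gT}) (y : I -> hT) (a : I -> nat) (i0 j0 : I) :
  schur_cover G f ->
  (forall i, y i \in H) -> (forall i, f (y i) = x i) ->
  i0 != j0 -> #[x j0] %| #[x i0] ->
  (forall j, commute (\prod_i y i ^+ a i) (y j)) ->
  x j0 ^+ a i0 = 1 /\ x j0 ^+ a j0 = 1.
Proof.
move=> cover_f Hy fy i0j0 dvd_x cy.
pose t i j := if (i == i0) && (j == j0) then x j0 else 1.
have Gt i j : t i j \in G.
  by rewrite /t; case: ifP => // _; apply: bigdprod_cycle_mem.
have tl i j : t i j ^+ #[x i] = 1.
  rewrite /t; case: ifP => [/andP[/eqP-> _]|_]; last by rewrite expg1n.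
  by apply/eqP; rewrite -order_dvdn.
have tr i j : t i j ^+ #[x j] = 1.
  rewrite /t; case: ifP => [/andP[_ /eqP->]|_]; last by rewrite expg1n.
  exact: expg_order.
have rel := schur_cover_alternating cover_f Hy fy bigdprod_cycle_abelian
  Gt tl tr (cy _).
have only (i1 : I) F :
    (forall i, i != i1 -> F i = 1) -> \prod_i F i = F i1 :> gT.
  move=> F1; transitivity (\prod_(i | i == i1) F i); last first.
    by rewrite big_pred1_eq.
  by rewrite [RHS]big_mkcond; apply: eq_bigr => i _; case: eqP => // /eqP/F1.
split.
  have := rel j0; rewrite (only i0) => [|i /negPf i_i0].
    by rewrite /t !eqxx [j0 == i0]eq_sym (negPf i0j0) /= invg1 mulg1.
  by rewrite /t i_i0 [j0 == i0]eq_sym (negPf i0j0) /= invg1 mulg1 expg1n.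
have := rel i0; rewrite (only j0) => [|i /negPf i_j0].
  rewrite /t !eqxx [j0 == i0]eq_sym (negPf i0j0) /= mul1g expgVn => /eqP.
  by rewrite invg_eq1 => /eqP.
by rewrite /t i_j0 (negPf i0j0) andbF eqxx /= invg1 mulg1 expg1n.
Qed.

End CyclicDecomposition.

(** * Dominant vertices *)

Theorem theorem4p4 (gT : finGroupType) (G : {group gT}) (p k : nat)
  (x : nat -> gT) (r : nat -> nat)
  (hT : finGroupType) (H : {group hT}) (f : {morphism H >-> gT}) :
  prime p -> (2 <= k)%N ->
  \big[dprod/1]_(i < k) <[x i]> = G ->
  (forall i, (i < k)%N -> #[x i] = (p ^ r i)%N) ->
  (forall i j, (i <= j < k)%N -> (r j <= r i)%N) ->
  ~~ cyclic G ->
  schur_cover G f ->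
  forall g : gT, dominant G f g <-> g \in <[x 0%N ^+ (p ^ r 1%N)]>.
Proof.
move=> _ k_gt1 dxG ox r_mono _ cover_f g.
have [[fHG sKZH'] _] := cover_f; have stem_f : stem_ext G f by [].
(* Indices start at 0: [i0] and [i1] stand for the first two factors, and [p ^ r 1] is the order of
   the second. *)
pose i0 : 'I_k := Ordinal (ltnW k_gt1); pose i1 : 'I_k := Ordinal k_gt1.
have /fin_all_exists2[y Hy fy] (i : 'I_k) : exists2 h, h \in H & f h = x i.
  have := bigdprod_cycle_mem dxG i; rewrite -{1}fHG.
  by case/morphimP=> h _ Hh ->; exists h.
split=> [[Gg dom_g]|].
  have [e eP] := bigdprod_cycle_coord dxG; have [eg _] := eP g Gg.
  have Hu : \prod_i y i ^+ e g i \in H.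
    by apply: group_prod => i _; rewrite groupX.
  have fu : f (\prod_i y i ^+ e g i) = g.
    rewrite [RHS]eg morph_prod => [|i _]; last by rewrite groupX.
    by apply: eq_bigr => i _; rewrite morphX // fy.
  have cy j : commute (\prod_i y i ^+ e g i) (y j).
    (* Dominance says nothing about [g] against itself; if [x j = g], the two lifts differ by a
       central kernel element. *)
    have [xjg | /eqP xjg] := eqVneq (x j) g; last first.
      by apply: (dom_g (x j)) => //; apply: (bigdprod_cycle_mem dxG).
    have /rcosetP[z Kz ->] : \prod_i y i ^+ e g i \in 'ker f :* y j.
      by apply/rcoset_kerP; rewrite // fu fy.
    have /centerP[_ czH] : z \in 'Z(H).
      by apply: subsetP Kz; case/subsetIP: sKZH'.
    apply/commute_sym/commuteM; last exact: commute_refl.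
    exact/commute_sym/czH.
  have pair (j : 'I_k) : i0 != j -> x j ^+ e g i0 = 1 /\ x j ^+ e g j = 1.
    move=> i0j; apply: (schur_cover_commute_pair dxG cover_f Hy fy) => //=.
    rewrite (ox _ (ltn_ord j)) (ox _ (ltnW k_gt1)) dvdn_exp2l //.
    by rewrite r_mono ?ltn_ord.
  (* The second factor makes [p ^ r 1] divide the exponent of [x 0]; the second halves of [pair]
     remove all other factors. *)
  have [x1e _] := pair i1 isT.
  have /dvdnP[n en] : (p ^ r 1 %| e g i0)%N.
    by rewrite -ox // order_dvdn; apply/eqP.
  suff -> : g = x 0%N ^+ e g i0 by rewrite en mulnC expgM mem_cycle.
  rewrite {1}eg; transitivity (\prod_(i | i == i0) x i ^+ e g i).
    rewrite [RHS]big_mkcond; apply: eq_bigr => i _.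
    by case: eqVneq => // ii0; rewrite (pair i _).2 // eq_sym.
  by rewrite big_pred1_eq.
case/cycleP=> n ->; split=> [|h Gh _ u v Hu Hv fu _].
  by rewrite !groupX // (bigdprod_cycle_mem dxG i0).
(* Since [r] is non-increasing, [p ^ r 1] is a multiple of the order of every generator but [x 0],
   so any lift is central. *)
suff /centerP[_ cuH] : u \in 'Z(H) by apply: cuH.
apply: (stem_ext_center dxG stem_f Hy fy (i0 := i0)
  (m := (p ^ r 1 * n)%N)) => //.
  move=> j j0; rewrite ox // dvdn_mulr // dvdn_exp2l // r_mono //=.
  by rewrite ltn_ord andbT lt0n.
by rewrite fu -expgM.
Qed.
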